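(* Let $f=(\alpha_1\cdots\alpha_n)$ be an $n$-player rule. Let $P\in\mathcal{L}$ and let $Q\in\mathrm{Sol}_fP$, i.e. $P\to Q$ is a solution move. Then $\mathrm{ord}_fQ\leqslant n-1$ and $\mathrm{ord}_fP=\mathrm{ord}_fQ+1$.
   Context: Positions are finite tuples $P=(a_1,\dots,a_k)$ of integers with $a_1\geqslant\dots\geqslant a_k\geqslant0$, where tuples differing only by trailing zeros are identified. $(0)$ is the empty position, $\mathcal{L}$ is the set of positions other than $(0)$, and $|P|=\sum a_i$ is the volume of $P$. A chomp move $P\to Q$ from $P=(a_1,\dots,a_k)$ chooses $1\leqslant x\leqslant k$ and an integer $a\geqslant0$, and sets $Q=(b_1,\dots,b_k)$ with $b_j=a_j$ for $j<x$ and $b_j=\min(a_j,a)$ for $j\geqslant x$, where $Q$ must be a different position from $P$. Write $\mathrm{Mov}P=\{Q: P\to Q\}$. Note that $(0)\in\mathrm{Mov}P$ for every $P\in\mathcal{L}$. An $n$-player rule is a tuple $f=(\alpha_1\cdots\alpha_n)$ of distinct reals. Ordinals $\mathrm{ord}_f$ are defined recursively on volume as follows. - $\mathrm{ord}_f(0)=0$. - For a position $Q$ whose ordinal is known, set $s_f(Q)=\alpha_{\mathrm{ord}_fQ+1}$ if $\mathrm{ord}_fQ<n$ and $s_f(Q)=\alpha_1$ if $\mathrm{ord}_fQ=n$. This is the score obtained by a player who moves to $Q$ when all players play optimally. - For $P\in\mathcal{L}$, $\mathrm{ord}_fP$ is the unique $i\in\{1,\dots,n\}$ with $\alpha_i=\max_{Q\in\mathrm{Mov}P}s_f(Q)$.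 Thus $\alpha_{\mathrm{ord}_fP}$ is player 1's score under optimal play from $P$. The solution set is defined as follows. If $s_f((0))$ equals this maximum, then $\mathrm{Sol}_fP=\{(0)\}$ (player's preference). Otherwise $\mathrm{Sol}_fP$ is the set of $Q\in\mathrm{Mov}P$ with $s_f(Q)=\max_{Q'\in\mathrm{Mov}P}s_f(Q')$. A move $P\to Q$ with $Q\in\mathrm{Sol}_fP$ is called a solution move. *)

(* Defs.v *)
From HB Require Import structures.
From mathcomp Require Import all_boot all_order all_algebra.
From mathcomp Require Import reals.

Set Implicit Arguments.
Unset Strict Implicit.
Unset Printing Implicit Defensive.

Import Order.TTheory GRing.Theory Num.Theory.

(* Tuples differing by trailing zeros are identified by taking, in each class,
   the unique representative without zero entries; (0) is thus [::]. *)
Definition is_position (s : seq nat) : bool := sorted geq s && (0 \notin s).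

Record position := Position {
  pos_seq :> seq nat;
  pos_seqP : is_position pos_seq }.

HB.instance Definition _ := [isSub for pos_seq].
HB.instance Definition _ := [Countable of position by <:].

Definition pos0 : position := @Position [::] isT.

Definition volume (P : position) : nat := sumn P.

(* (b_1, ..., b_k), with rows numbered from 0; trailing zeros are not yet
   removed. *)
Definition chomp_seq (s : seq nat) (x a : nat) : seq nat :=
  mkseq (fun j => if j < x then nth 0 s j else minn (nth 0 s j) a) (size s).

Definition strip (s : seq nat) : seq nat := [seq b <- s | b != 0].

Lemma strip_chomp_is_position (P : position) (x a : nat) :
  is_position (strip (chomp_seq P x a)).
Proof.
case: P => s /= /andP[ss _]; apply/andP; split; last first.
  by rewrite mem_filter eqxx.
have geqT : transitive geq by move=> u v w /= h1 h2; apply: leq_trans h2 h1.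
apply: sorted_filter => //.
apply: (homo_sorted_in (e := leq) (P := [pred j | j < size s])).
- move=> i j; rewrite !inE => hi hj le_ij.
  have H : nth 0 s j <= nth 0 s i.
    by apply: (sorted_leq_nth geqT _ 0 ss) => //; move=> u /=.
  case: (ltnP j x) => hjx; first by rewrite /= (leq_ltn_trans le_ij hjx).
  case: ifP => _ /=; first exact: leq_trans (geq_minl _ _) H.
  by rewrite leq_min geq_minr (leq_trans (geq_minl _ _) H).
- by apply/allP => i; rewrite mem_iota add0n !inE.
- exact: iota_sorted.
Qed.

Definition chomp (P : position) (x a : nat) : position :=
  Position (strip_chomp_is_position P x a).

Definition chomp_move (P Q : position) : Prop :=
  exists x a : nat, [/\ x < size P, Q = chomp P x a & Q <> P].

(* A finite enumeration of the moves: values a > a_1 leave P unchanged, so that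
   membership in Mov P is equivalent to chomp_move P Q by MovP. *)
Definition Mov (P : position) : seq position :=
  [seq Q <- [seq chomp P x a | x <- iota 0 (size P),
                               a <- iota 0 (head 0 P).+1] | Q != P].

Lemma strip_id (P : position) : strip P = P.
Proof.
case: P => s /= /andP[_ s0]; apply/all_filterP/allP => b bs.
by apply: contraNneq s0 => <-.
Qed.

Lemma pos_nth_le_head (P : position) (j : nat) : nth 0 P j <= head 0 P.
Proof.
case: P => s /= /andP[ss _].
have geqT : transitive geq by move=> u v w /= h1 h2; apply: leq_trans h2 h1.
case: (ltnP j (size s)) => hj; last by rewrite nth_default.
rewrite -nth0.
by apply: (sorted_leq_nth geqT _ 0 ss) => //; rewrite ?inE //;
  [move=> u /=| apply: leq_ltn_trans hj].
Qed.

Lemma MovP (P Q : position) : reflect (chomp_move P Q) (Q \in Mov P).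
Proof.
apply: (iffP idP) => [|[x [a [xP -> QP]]]].
  rewrite mem_filter => /andP[/eqP QP /allpairsP[[x a] /= [hx _ QE]]]; rewrite QE in QP *.
  by exists x, a; split => //; move: hx; rewrite mem_iota.
rewrite mem_filter; apply/andP; split; first exact/eqP.
apply/allpairsP; exists (x, minn a (head 0 P)); split.
- by rewrite mem_iota.
- by rewrite mem_iota ltnS geq_minr.
apply: val_inj => /=; congr (strip _); apply: eq_mkseq => j.
case: ifP => // _; rewrite [minn a _]minnC minnA.
by rewrite (minn_idPl (pos_nth_le_head P j)).
Qed.

Lemma pos0_in_Mov (P : position) : P != pos0 -> pos0 \in Mov P.
Proof.
move=> P0; apply/MovP; exists 0, 0; split; last by move=> E; rewrite E eqxx in P0.
  by rewrite lt0n size_eq0; apply: contraNneq P0 => E; apply/eqP/val_inj.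
apply: val_inj => /=; rewrite /strip.
by apply/esym/eqP; rewrite -[_ == _]negbK -has_filter; apply/hasPn => b
  /mapP[j _ ->]; rewrite ltn0 minn0.
Qed.

Lemma sumn_map_eq (g h : nat -> nat) (l : seq nat) :
  (forall i, g i <= h i) -> sumn (map h l) <= sumn (map g l) ->
  map g l = map h l.
Proof.
move=> gh; elim: l => //= j l IH le_v.
have hl : sumn (map g l) <= sumn (map h l).
  by elim: (l) => //= i t IHt; apply: leq_add.
have gE : g j = h j.
  apply/eqP; rewrite eqn_leq gh /= -(leq_add2r (sumn (map h l))).
  by apply: leq_trans le_v _; rewrite leq_add2l.
by rewrite IH ?gE //; move: le_v; rewrite gE leq_add2l.
Qed.

Lemma volume_Mov (P Q : position) : Q \in Mov P -> volume Q < volume P.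
Proof.
move=> /MovP[x [a [_ -> QP]]]; rewrite /volume /=.
have -> : sumn (strip (chomp_seq P x a)) = sumn (chomp_seq P x a).
  by elim: (chomp_seq _ _ _) => //= b s <-; case: b.
rewrite ltnNge; apply/negP => le_v; apply: QP; apply: val_inj => /=.
rewrite -[RHS]strip_id; congr strip.
have PE : mkseq (nth 0 P) (size P) = P by exact: mkseq_nth.
apply: etrans PE; apply: sumn_map_eq => [i|].
  by case: ifP => // _; apply: geq_minl.
by apply: leq_trans le_v; rewrite -/(mkseq _ _) mkseq_nth.
Qed.

Section Rule.
Variables (R : realType) (n : nat).
(* f = (alpha_1 ... alpha_n), so alpha_i is nth 0 f (i - 1); distinctness is
   [uniq f]. *)
Implicit Types (f : n.-tuple R) (P Q : position).

Definition score_of_ord f (o : nat) : R :=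
  nth 0%R f (if o < n then o else 0).

(* Since (0) is in Mov P for P <> (0), starting the iterated maximum at
   s_f((0)) does not change its value; see best_scoreP. *)
Definition best_score_from f (o : position -> nat) P : R :=
  \big[Num.max/score_of_ord f (o pos0)]_(Q <- Mov P) score_of_ord f (o Q).

(* The argument k bounds the recursion depth; any k >= volume P gives the
   same value, so that ordf satisfies the recursion of ordf_rec. The index of
   the maximum in f is 0-based, and its existence is best_score_in. *)
Fixpoint ordf_fuel f (k : nat) P : nat :=
  if k is k'.+1 then
    if P == pos0 then 0 else (index (best_score_from f (ordf_fuel f k') P) f).+1
  else 0.

Definition ordf f P : nat := ordf_fuel f (volume P) P.

Definition score f Q : R := score_of_ord f (ordf f Q).

Definition best_score f P : R := best_score_from f (ordf f) P.

Definition Sol f P : seq position :=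
  if score f pos0 == best_score f P then [:: pos0]
  else [seq Q <- Mov P | score f Q == best_score f P].

Lemma ordf_pos0 f : ordf f pos0 = 0. Proof. by []. Qed.

Lemma ordf_fuel_stable f k P : volume P <= k -> ordf_fuel f k P = ordf f P.
Proof.
have fuel0 m : ordf_fuel f m pos0 = 0 by case: m.
suff H m1 m2 P' : volume P' <= m1 -> volume P' <= m2 ->
    ordf_fuel f m1 P' = ordf_fuel f m2 P' by move=> hk; apply: H.
elim: m1 m2 P' => [|m1 IH] m2 P'; have [->|P0] := eqVneq P' pos0;
  rewrite ?fuel0 // => h1; have vP := volume_Mov (pos0_in_Mov P0).
  by rewrite ltnNge h1 in vP.
case: m2 => [h2|m2 h2]; first by rewrite ltnNge h2 in vP.
rewrite /= (negPf P0) /best_score_from !fuel0; congr (index _ _).+1.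
rewrite big_seq [RHS]big_seq; apply: eq_bigr => Q /volume_Mov vQ.
by rewrite (IH m2) // -ltnS (leq_trans vQ).
Qed.

Lemma ordf_rec f P : P != pos0 -> ordf f P = (index (best_score f P) f).+1.
Proof.
move=> P0; rewrite -(@ordf_fuel_stable f (volume P).+1) //= (negPf P0).
congr (index _ _).+1; rewrite /best_score /best_score_from.
rewrite (@ordf_fuel_stable f (volume P) pos0) // big_seq [RHS]big_seq.
apply: eq_bigr => Q /volume_Mov/ltnW QP.
by rewrite ordf_fuel_stable.
Qed.

Lemma best_scoreP f P : P != pos0 ->
  (exists2 Q, Q \in Mov P & score f Q = best_score f P) /\
  (forall Q, Q \in Mov P -> (score f Q <= best_score f P)%R).
Proof.
move=> P0; split; last by move=> Q QP; apply: le_bigmax_seq.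
have {P0} := pos0_in_Mov P0; rewrite /best_score /best_score_from => P0.
rewrite big_seq; elim/big_ind: _ => [|u v [Q QP <-] [Q' QP' <-]|Q QP].
- by exists pos0.
- by rewrite /Num.max; case: ifP => _; [exists Q'|exists Q].
- by exists Q.
Qed.

Lemma best_score_in f P : 0 < n -> P != pos0 -> best_score f P \in f.
Proof.
move=> n0 P0; have [[Q _ <-] _] := best_scoreP f P0.
by apply: mem_nth; rewrite size_tuple; case: ifP.
Qed.

Lemma ordfP f P : 0 < n -> P != pos0 ->
  0 < ordf f P <= n /\ nth 0%R f (ordf f P).-1 = best_score f P.
Proof.
move=> n0 P0; have bf := best_score_in f n0 P0.
by rewrite ordf_rec //= nth_index //; split => //; rewrite -{2}(size_tuple f) index_mem.
Qed.

End Rule.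

(* Main.v *)
Require Import Defs.
From mathcomp Require Import all_boot all_order all_algebra.
From mathcomp Require Import reals.

(** A solution move attains the best score, and player's preference excludes ordinal n: such a [Q]
    would tie with (0), forcing [Sol f P] to be {(0)}, of ordinal 0 < n. So [Q] scores alpha_(ord Q
    + 1), and as the alpha_i are distinct, that index is ord P ([ordf_of_best_score]). *)

Lemma ordf_of_best_score (R : realType) (n : nat) (f : n.-tuple R)
    (P Q : position) :
  uniq f -> P != pos0 -> ordf f Q < n -> score f Q = best_score f P ->
  ordf f P = (ordf f Q).+1.
Proof.
(* Counted from 0, alpha_(ord Q + 1) has index [ordf f Q]; [ordf_rec] supplies the successor. *)
move=> f_uniq P0 Qn QE; rewrite ordf_rec // -QE /score /score_of_ord Qn.
by rewrite index_uniq ?size_tuple.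
Qed.

Theorem theorem2p7 (R : realType) (n : nat) (f : n.-tuple R)
    (n_gt0 : 0 < n) (f_uniq : uniq f)
    (P : position) (P_neq0 : P <> pos0)
    (Q : position) (Q_sol : Q \in Sol f P) :
  ordf f Q <= n - 1 /\ ordf f P = ordf f Q + 1.
Proof.
suff [Qn QE] : ordf f Q < n /\ score f Q = best_score f P.
  rewrite addn1 leq_subRL // add1n; split=> //.
  exact: (ordf_of_best_score _ _ _ _ _ f_uniq (introN eqP P_neq0)).
move: Q_sol; rewrite /Sol; case: eqP => [sE|sNE].
  by rewrite inE => /eqP->; rewrite ordf_pos0.
rewrite mem_filter => /andP[/eqP QE _]; split=> //.
(* An ordinal equal to n would score alpha_1, which is the score of (0). *)
rewrite ltnNge; apply/negP => nQ; apply: sNE.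
by rewrite -QE /score /score_of_ord ordf_pos0 n_gt0 ltnNge nQ.
Qed.
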